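(* Let $\phi(z)=\mu z$ be a self-map of $\mathbb{D}$ with $\mu\ne0$, and let $\psi(z)=\sum_{k=1}^\infty\hat\psi_kz^k$ be analytic on $\mathbb{D}$, such that $C_{\psi,\phi}$ is a bounded operator on $\mathcal{D}$. Then for every integer $r\ge2$, the numerical range $W(C_{\psi,\phi})$ contains a disk centered at the origin with radius $\frac{\sqrt{r+1}}{2\sqrt2}|\hat\psi_{r-1}\mu|$.
   Context: $\mathbb{D}=\{z\in\mathbb{C}:|z|<1\}$. The Dirichlet space $\mathcal{D}$ is the Hilbert space of all holomorphic $f(z)=\sum_{n\ge0}\hat f_nz^n$ on $\mathbb{D}$ with $\sum_{n\ge 0}(n+1)|\hat f_n|^2<\infty$ (equivalently $\int_{\mathbb{D}}|f'|^2dA<\infty$), with inner product $\langle f,g\rangle_{\mathcal{D}}=\sum_{n\ge0}(n+1)\hat f_n\overline{\hat g_n}$. The weighted composition operator is $(C_{\psi,\phi}f)(z)=\psi(z)f(\phi(z))$. The numerical range of a bounded operator $T$ on a Hilbert space $\mathcal{H}$ is $W(T)=\{\langle Tf,f\rangle:f\in\mathcal{H},\|f\|=1\}$. *)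

(* Defs.v *)
From Stdlib Require Import Reals ClassicalEpsilon.
From Coquelicot Require Import Coquelicot.

Local Open Scope C_scope.

(* Functions on the disk are total functions C -> C; every notion below only
   looks at their values on the open unit disk. *)
Definition unit_disk (z : C) : Prop := (Cmod z < 1)%R.

Definition holomorphic_on_disk (f : C -> C) : Prop :=
  forall z : C, unit_disk z -> @ex_derive C_AbsRing C_NormedModule f z.

Definition power_series_on_disk (a : nat -> C) (f : C -> C) : Prop :=
  forall z : C, unit_disk z -> @is_pseries C_AbsRing C_NormedModule a z (f z).

(* The coefficients of a power series are determined by its sum on the disk,
   so the choice is unique whenever an expansion exists. *)
Definition taylor_coef (f : C -> C) : nat -> C :=
  epsilon (inhabits (fun _ : nat => RtoC 0))
    (fun a : nat -> C => power_series_on_disk a f).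

Definition in_dirichlet (f : C -> C) : Prop :=
  holomorphic_on_disk f /\
  power_series_on_disk (taylor_coef f) f /\
  ex_series (fun n : nat => ((INR n + 1) * Cmod (taylor_coef f n) ^ 2)%R).

(* Coquelicot's [Series] is real-valued, hence the componentwise sum. *)
Definition CSeries (u : nat -> C) : C :=
  (Series (fun n => Re (u n)), Series (fun n => Im (u n))).

Definition dirichlet_inner (f g : C -> C) : C :=
  CSeries (fun n : nat =>
    RtoC (INR n + 1) * taylor_coef f n * Cconj (taylor_coef g n)).

Definition dirichlet_norm (f : C -> C) : R := sqrt (Re (dirichlet_inner f f)).

Definition bounded_operator_on_dirichlet (T : (C -> C) -> (C -> C)) : Prop :=
  (forall f, in_dirichlet f -> in_dirichlet (T f)) /\
  (forall (c : C) (f g : C -> C), in_dirichlet f -> in_dirichlet g ->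
     forall z, unit_disk z ->
       T (fun x => c * f x + g x) z = c * T f z + T g z) /\
  (exists M : R, forall f, in_dirichlet f ->
     (dirichlet_norm (T f) <= M * dirichlet_norm f)%R).

Definition numerical_range (T : (C -> C) -> (C -> C)) (w : C) : Prop :=
  exists f : C -> C,
    in_dirichlet f /\ dirichlet_norm f = 1%R /\ w = dirichlet_inner (T f) f.

Definition weighted_composition (psi phi : C -> C) (f : C -> C) : C -> C :=
  fun z => psi z * f (phi z).

(* Main.v *)
Require Import Defs.
From Stdlib Require Import Reals.
From Coquelicot Require Import Coquelicot.
From Stdlib Require Import Lra Lia Arith ClassicalEpsilon.

(** Write T for the operator f |-> psi * (f o phi). It is tested on the plane
    spanned by z and z^r. Since psi vanishes at 0, multiplication by psi
    strictly raises the order of vanishing at 0: T z = mu z psi(z) starts at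
    z^2 and T z^r = mu^r z^r psi(z) starts at z^(r+1). On f = a z + b z^r the
    only surviving pairing is therefore that of T z with z^r, and
      <T f, f> = (r+1) psihat_(r-1) mu a conj(b)
    ([weighted_two_term_inner]), while ||f||^2 = 2 |a|^2 + (r+1) |b|^2.

    After normalising, a = a' / sqrt 2 and b = b' / sqrt (r+1) with
    |a'|^2 + |b'|^2 = 1, and
      <T f, f> = sqrt (r+1) / sqrt 2 * psihat_(r-1) mu * a' conj(b').
    The products a' conj(b') over the unit sphere of C^2 fill the closed disk of
    radius 1/2 ([half_disk_product]), which gives the disk of the theorem.

    The inner product is defined through a chosen sequence of Taylor
    coefficients, so these computations rest on the uniqueness of power series
    on the disk ([power_series_on_disk_unique]). It is reduced to the real case
    by restricting to real arguments and splitting into real and imaginary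
    parts. *)

(** * Series with few terms and componentwise complex series *)

Lemma is_series_single (K : AbsRing) (V : NormedModule K) (u : nat -> V) (m : nat) :
  (forall n, n <> m -> u n = zero) -> is_series u (u m).
Proof.
  intros H.
  assert (Hs : forall n, sum_n u n = if le_lt_dec m n then u m else zero).
  { induction n as [|n IH].
    - rewrite sum_O. destruct (le_lt_dec m 0) as [h|h].
      + replace m with 0%nat by lia; reflexivity.
      + apply H; lia.
    - rewrite sum_Sn, IH.
      destruct (le_lt_dec m n) as [h|h], (le_lt_dec m (S n)) as [h'|h']; try lia.
      + rewrite (H (S n)) by lia. apply plus_zero_r.
      + replace m with (S n) by lia. apply plus_zero_l.
      + rewrite (H (S n)) by lia. apply plus_zero_l. }
  unfold is_series.
  (* The partial sums are constant from index m on. *)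
  apply filterlim_ext_loc with (f := fun _ : nat => u m).
  - exists m. intros n hn. rewrite Hs. destruct (le_lt_dec m n); [reflexivity | lia].
  - apply filterlim_const.
Qed.

(** Gives the value of every series attached to a two-term polynomial at once:
    its power series, its norm and its inner products. *)
Lemma is_series_pair (K : AbsRing) (V : NormedModule K) (u : nat -> V) (m k : nat) :
  m <> k -> (forall n, n <> m -> n <> k -> u n = zero) ->
  is_series u (plus (u m) (u k)).
Proof.
  intros Hmk H.
  set (v := fun j n => if Nat.eq_dec n j then u j else zero).
  assert (Hv : forall j, is_series (v j) (u j)).
  { intros j.
    replace (u j) with (v j j)
      by (unfold v; destruct (Nat.eq_dec j j); [reflexivity | lia]).
    apply is_series_single. intros n hn. unfold v.
    destruct (Nat.eq_dec n j); [contradiction | reflexivity]. }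
  apply is_series_ext with (a := fun n => plus (v m n) (v k n)).
  - intros n. unfold v.
    destruct (Nat.eq_dec n m) as [e|h], (Nat.eq_dec n k) as [e'|h'].
    + congruence.
    + subst n. apply plus_zero_r.
    + subst n. apply plus_zero_l.
    + rewrite H by assumption. apply plus_zero_r.
  - exact (is_series_plus _ _ _ _ (Hv m) (Hv k)).
Qed.

Lemma is_series_Re (u : nat -> C) (l : C) :
  @is_series C_AbsRing C_NormedModule u l -> is_series (fun n => Re (u n)) (Re l).
Proof.
  intros H. unfold is_series.
  apply filterlim_ext with (f := fun n => Re (@sum_n C_NormedModule u n)).
  - induction x as [|n IH].
    + now rewrite !sum_O.
    + rewrite !sum_Sn, <- IH. reflexivity.
  - apply (filterlim_comp _ _ _ _ _ _ _ _ H).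
    intros P [e He]. exists e. intros y Hy. exact (He _ (proj1 Hy)).
Qed.

Lemma is_series_Im (u : nat -> C) (l : C) :
  @is_series C_AbsRing C_NormedModule u l -> is_series (fun n => Im (u n)) (Im l).
Proof.
  intros H. unfold is_series.
  apply filterlim_ext with (f := fun n => Im (@sum_n C_NormedModule u n)).
  - induction x as [|n IH].
    + now rewrite !sum_O.
    + rewrite !sum_Sn, <- IH. reflexivity.
  - apply (filterlim_comp _ _ _ _ _ _ _ _ H).
    intros P [e He]. exists e. intros y Hy. exact (He _ (proj2 Hy)).
Qed.

Lemma CSeries_unique (u : nat -> C) (l : C) :
  @is_series C_AbsRing C_NormedModule u l -> CSeries u = l.
Proof.
  intros H. unfold CSeries.
  rewrite (is_series_unique _ _ (is_series_Re _ _ H)).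
  rewrite (is_series_unique _ _ (is_series_Im _ _ H)).
  now destruct l.
Qed.

(** * Uniqueness of power series on the disk *)

(** Beyond the radius of convergence the terms cannot tend to 0, so convergence
    at one positive point bounds the radius away from 0. *)
Lemma CV_radius_pos (a : nat -> R) (x : R) :
  (0 < x)%R -> ex_pseries a x -> Rbar_lt 0 (CV_radius a).
Proof.
  intros Hx H. apply Rbar_not_le_lt. intros Hle.
  apply (CV_disk_outside a x).
  - apply Rbar_le_lt_trans with (1 := Hle). simpl.
    now rewrite Rabs_pos_eq; [|lra].
  - apply ex_series_lim_0. apply ex_series_ext with (2 := H).
    intros n. change (pow_n x n * a n = a n * x ^ n)%R.
    rewrite pow_n_pow. ring.
Qed.

Lemma real_power_series_unique (a b : nat -> R) (f : R -> R) :
  (forall x : R, (Rabs x < 1)%R -> is_pseries a x (f x)) ->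
  (forall x : R, (Rabs x < 1)%R -> is_pseries b x (f x)) ->
  forall n, a n = b n.
Proof.
  intros Ha Hb n.
  (* The point 1/2 is an arbitrary positive point of the disk. *)
  assert (H12 : (Rabs (/ 2) < 1)%R) by (rewrite Rabs_pos_eq; lra).
  apply PSeries_ext_recip.
  - apply CV_radius_pos with (/ 2)%R; [lra | eexists; now apply Ha].
  - apply CV_radius_pos with (/ 2)%R; [lra | eexists; now apply Hb].
  - exists (mkposreal 1 Rlt_0_1). intros x Hx.
    assert (Hx' : (Rabs x < 1)%R).
    { replace x with (minus x 0%R); [exact Hx | apply Rminus_0_r]. }
    now rewrite (is_pseries_unique _ _ _ (Ha x Hx')),
      (is_pseries_unique _ _ _ (Hb x Hx')).
Qed.

(** Powers of a real x are real, so taking real or imaginary parts of the terms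
    acts on the coefficients alone. *)
Lemma power_series_on_disk_real (a : nat -> C) (f : C -> C) (x : R) :
  power_series_on_disk a f -> (Rabs x < 1)%R ->
  is_pseries (fun n => Re (a n)) x (Re (f (RtoC x))) /\
  is_pseries (fun n => Im (a n)) x (Im (f (RtoC x))).
Proof.
  intros H Hx.
  assert (Hd : unit_disk (RtoC x)) by (unfold unit_disk; now rewrite Cmod_R).
  assert (Hp : forall n, @pow_n C_Ring (RtoC x) n = RtoC (x ^ n)).
  { induction n as [|n IH]; [reflexivity|].
    simpl. rewrite IH, RtoC_mult. reflexivity. }
  split.
  - apply is_series_ext with (2 := is_series_Re _ _ (H _ Hd)).
    intros n.
    change (Re (@pow_n C_Ring (RtoC x) n * a n)%C = pow_n x n * Re (a n))%R.
    rewrite pow_n_pow, Hp. unfold Re, Im. simpl. ring.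
  - apply is_series_ext with (2 := is_series_Im _ _ (H _ Hd)).
    intros n.
    change (Im (@pow_n C_Ring (RtoC x) n * a n)%C = pow_n x n * Im (a n))%R.
    rewrite pow_n_pow, Hp. unfold Re, Im. simpl. ring.
Qed.

Lemma power_series_on_disk_unique (a b : nat -> C) (f : C -> C) :
  power_series_on_disk a f -> power_series_on_disk b f -> forall n, a n = b n.
Proof.
  intros Ha Hb n. apply injective_projections.
  - exact (real_power_series_unique (fun n => Re (a n)) (fun n => Re (b n))
             (fun x => Re (f (RtoC x)))
             (fun x Hx => proj1 (power_series_on_disk_real _ _ _ Ha Hx))
             (fun x Hx => proj1 (power_series_on_disk_real _ _ _ Hb Hx)) n).
  - exact (real_power_series_unique (fun n => Im (a n)) (fun n => Im (b n))
             (fun x => Im (f (RtoC x)))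
             (fun x Hx => proj2 (power_series_on_disk_real _ _ _ Ha Hx))
             (fun x Hx => proj2 (power_series_on_disk_real _ _ _ Hb Hx)) n).
Qed.

Lemma taylor_coef_spec (a : nat -> C) (f : C -> C) :
  power_series_on_disk a f -> power_series_on_disk (taylor_coef f) f.
Proof. intros H. unfold taylor_coef. apply epsilon_spec. now exists a. Qed.

(** Whatever sequence the choice operator selects, it may be computed from any
    known expansion. *)
Lemma taylor_coef_unique (a : nat -> C) (f : C -> C) (n : nat) :
  power_series_on_disk a f -> taylor_coef f n = a n.
Proof.
  intros H. exact (power_series_on_disk_unique _ _ _ (taylor_coef_spec _ _ H) H n).
Qed.

(** * Two-term polynomials in the Dirichlet space *)

Local Open Scope C_scope.

Definition two_term (r : nat) (a b : C) (z : C) : C := a * z + b * z ^ r.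

Definition two_term_coef (r : nat) (a b : C) (n : nat) : C :=
  if n =? 1 then a else if n =? r then b else 0.

Lemma pow_n_Cpow (z : C) (n : nat) : @pow_n C_Ring z n = z ^ n.
Proof.
  induction n as [|n IH]; [reflexivity|].
  rewrite Cpow_S, <- IH. reflexivity.
Qed.

Lemma two_term_coef_1 (r : nat) (a b : C) : two_term_coef r a b 1 = a.
Proof. reflexivity. Qed.

Lemma two_term_coef_r (r : nat) (a b : C) : r <> 1%nat -> two_term_coef r a b r = b.
Proof.
  intros hr. unfold two_term_coef.
  rewrite (proj2 (Nat.eqb_neq r 1) hr), Nat.eqb_refl. reflexivity.
Qed.

Lemma two_term_coef_other (r : nat) (a b : C) (n : nat) :
  n <> 1%nat -> n <> r -> two_term_coef r a b n = 0.
Proof.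
  intros h1 hr. unfold two_term_coef.
  now rewrite (proj2 (Nat.eqb_neq n 1) h1), (proj2 (Nat.eqb_neq n r) hr).
Qed.

Lemma power_series_two_term (r : nat) (a b : C) :
  r <> 1%nat -> power_series_on_disk (two_term_coef r a b) (two_term r a b).
Proof.
  intros hr z _. unfold is_pseries.
  set (u := fun k : nat => _).
  replace (two_term r a b z) with (u 1%nat + u r).
  - apply (is_series_pair C_AbsRing C_NormedModule); [congruence|].
    intros n h1 h2. unfold u. rewrite two_term_coef_other by assumption.
    apply (@scal_zero_r C_AbsRing C_NormedModule).
  - unfold u. rewrite two_term_coef_1, two_term_coef_r by assumption.
    change (@pow_n C_Ring z 1 * a + @pow_n C_Ring z r * b = two_term r a b z).
    rewrite (pow_n_Cpow z 1), (pow_n_Cpow z r). unfold two_term. ring.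
Qed.

Lemma ex_derive_Cmult (f g : C -> C) (z : C) :
  @ex_derive C_AbsRing (AbsRing_NormedModule C_AbsRing) f z ->
  @ex_derive C_AbsRing (AbsRing_NormedModule C_AbsRing) g z ->
  @ex_derive C_AbsRing (AbsRing_NormedModule C_AbsRing) (fun x => f x * g x) z.
Proof.
  intros [df Hf] [dg Hg]. eexists.
  exact (@is_derive_mult C_AbsRing f g z df dg Hf Hg Cmult_comm).
Qed.

Lemma ex_derive_Cpow (n : nat) (z : C) :
  @ex_derive C_AbsRing (AbsRing_NormedModule C_AbsRing) (fun x : C => x ^ n) z.
Proof.
  induction n as [|n IH].
  - exact (@ex_derive_const C_AbsRing (AbsRing_NormedModule C_AbsRing) (RtoC 1) z).
  - exact (ex_derive_Cmult (fun x => x) (fun x => x ^ n) z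
             (@ex_derive_id C_AbsRing z) IH).
Qed.

(** The normed modules [AbsRing_NormedModule C_AbsRing] and [C_NormedModule]
    carry different uniform structures, the second one being a product, but the
    derivative of a function with values in them only sees the modulus, which
    they share. The product rule is available for the first; holomorphy is
    stated with the second. *)
Lemma ex_derive_C_NormedModule (f : C -> C) (z : C) :
  @ex_derive C_AbsRing (AbsRing_NormedModule C_AbsRing) f z ->
  @ex_derive C_AbsRing C_NormedModule f z.
Proof.
  intros [l [[Hplus Hscal Hnorm] Hdom]]. exists l. split.
  - constructor; [exact Hplus | exact Hscal | exact Hnorm].
  - exact Hdom.
Qed.

Lemma holomorphic_two_term (r : nat) (a b : C) :
  holomorphic_on_disk (two_term r a b).
Proof.
  intros z _. apply ex_derive_C_NormedModule.
  exact (@ex_derive_plus C_AbsRing (AbsRing_NormedModule C_AbsRing) _ _ z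
    (ex_derive_Cmult (fun _ => a) (fun x => x) z
       (@ex_derive_const C_AbsRing (AbsRing_NormedModule C_AbsRing) a z)
       (@ex_derive_id C_AbsRing z))
    (ex_derive_Cmult (fun _ => b) (fun x => x ^ r) z
       (@ex_derive_const C_AbsRing (AbsRing_NormedModule C_AbsRing) b z)
       (ex_derive_Cpow r z))).
Qed.

Lemma in_dirichlet_two_term (r : nat) (a b : C) :
  r <> 1%nat -> in_dirichlet (two_term r a b).
Proof.
  intros hr. pose proof (power_series_two_term r a b hr) as H.
  split; [apply holomorphic_two_term | split].
  - exact (taylor_coef_spec _ _ H).
  - eexists. apply (is_series_pair R_AbsRing R_NormedModule _ 1 r); [congruence|].
    intros n h1 h2. rewrite (taylor_coef_unique _ _ n H).
    rewrite two_term_coef_other by assumption. rewrite Cmod_0.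
    change ((INR n + 1) * 0 ^ 2 = 0)%R. ring.
Qed.

(** Pairing with a polynomial only sees the coefficients of g at its
    exponents; this serves both for the norm and for <T f, f>. *)
Lemma dirichlet_inner_two_term (g : C -> C) (d : nat -> C) (r : nat) (a b : C) :
  r <> 1%nat -> power_series_on_disk d g ->
  dirichlet_inner g (two_term r a b)
  = RtoC 2 * d 1%nat * Cconj a + RtoC (INR r + 1) * d r * Cconj b.
Proof.
  intros hr Hd. pose proof (power_series_two_term r a b hr) as H.
  unfold dirichlet_inner. apply CSeries_unique.
  set (u := fun n : nat => _).
  replace (_ + _) with (u 1%nat + u r).
  - apply (is_series_pair C_AbsRing C_NormedModule); [congruence|].
    intros n h1 h2. unfold u. rewrite (taylor_coef_unique _ _ n H).
    rewrite two_term_coef_other by assumption.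
    change (RtoC (INR n + 1) * taylor_coef g n * Cconj 0 = 0).
    replace (Cconj 0) with (RtoC 0) by (apply injective_projections; simpl; ring).
    ring.
  - unfold u. rewrite !(taylor_coef_unique _ _ _ H), !(taylor_coef_unique _ _ _ Hd).
    rewrite two_term_coef_1, two_term_coef_r by assumption.
    replace (INR 1 + 1)%R with 2%R by (simpl; ring). reflexivity.
Qed.

Lemma dirichlet_norm_two_term (r : nat) (a b : C) :
  r <> 1%nat ->
  dirichlet_norm (two_term r a b)
  = sqrt (2 * Cmod a ^ 2 + (INR r + 1) * Cmod b ^ 2).
Proof.
  intros hr. unfold dirichlet_norm.
  rewrite (dirichlet_inner_two_term _ _ r a b hr (power_series_two_term r a b hr)).
  rewrite two_term_coef_1, two_term_coef_r by assumption.
  rewrite <- !Cmult_assoc, <- !Cmod2_conj, <- !RtoC_mult, <- RtoC_plus.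
  reflexivity.
Qed.

(** * The quadratic form of the operator on two-term polynomials *)

(** On the disk, T f = a mu * (z psi) + b mu^r * (z^r psi), and multiplying by a
    power of z shifts coefficients. *)
Lemma power_series_weighted_two_term (phi psi : C -> C) (mu : C)
    (psihat : nat -> C) (r : nat) (a b : C) :
  (forall z : C, unit_disk z -> phi z = mu * z) ->
  power_series_on_disk psihat psi ->
  power_series_on_disk
    (@PS_plus C_AbsRing C_NormedModule
       (@PS_scal C_AbsRing C_NormedModule (a * mu)
          (@PS_incr_n C_AbsRing C_NormedModule psihat 1))
       (@PS_scal C_AbsRing C_NormedModule (b * mu ^ r)
          (@PS_incr_n C_AbsRing C_NormedModule psihat r)))
    (weighted_composition psi phi (two_term r a b)).
Proof.
  intros Hphi Hpsi z Hz.
  replace (weighted_composition psi phi (two_term r a b) z)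
    with (a * mu * (z ^ 1 * psi z) + b * mu ^ r * (z ^ r * psi z))
    by (unfold weighted_composition, two_term; rewrite Hphi, Cpow_mult_l by assumption;
        ring).
  rewrite <- (pow_n_Cpow z 1), <- (pow_n_Cpow z r).
  apply (@is_pseries_plus C_AbsRing C_NormedModule);
    apply (@is_pseries_scal C_AbsRing C_NormedModule); try apply Cmult_comm;
    apply (@is_pseries_incr_n C_AbsRing C_NormedModule); now apply Hpsi.
Qed.

(** At exponent 1 the coefficient of T f is a mu psihat_0 = 0, and at exponent r
    it is a mu psihat_(r-1) + b mu^r psihat_0 = a mu psihat_(r-1). *)
Lemma weighted_two_term_inner (phi psi : C -> C) (mu : C)
    (psihat : nat -> C) (r : nat) (a b : C) :
  (2 <= r)%nat ->
  (forall z : C, unit_disk z -> phi z = mu * z) ->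
  power_series_on_disk psihat psi ->
  psihat 0%nat = 0 ->
  dirichlet_inner (weighted_composition psi phi (two_term r a b)) (two_term r a b)
  = RtoC (INR r + 1) * (psihat (r - 1)%nat * mu) * (a * Cconj b).
Proof.
  intros hr Hphi Hpsi H0.
  rewrite (dirichlet_inner_two_term _ _ r a b ltac:(lia)
             (power_series_weighted_two_term _ _ _ _ r a b Hphi Hpsi)).
  unfold PS_plus, PS_scal.
  rewrite !PS_incr_n_simplify.
  destruct (le_lt_dec 1 1); [|lia]. destruct (le_lt_dec r 1); [lia|].
  destruct (le_lt_dec 1 r); [|lia]. destruct (le_lt_dec r r); [|lia].
  rewrite !Nat.sub_diag, H0.
  change (RtoC 2 * (a * mu * 0 + b * mu ^ r * 0) * Cconj a
    + RtoC (INR r + 1) * (a * mu * psihat (r - 1)%nat + b * mu ^ r * 0) * Cconj b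
    = RtoC (INR r + 1) * (psihat (r - 1)%nat * mu) * (a * Cconj b)).
  ring.
Qed.

(** * Filling the disk *)

(** With a = p > 0 real, b is forced to be conj(s) / p, and the sphere condition
    p^2 + |s|^2 / p^2 = 1 is a quadratic equation in p^2 of discriminant
    1 - 4 |s|^2, nonnegative exactly because |s| <= 1/2. The larger root is
    at least 1/2, so the division by p is legitimate even when s = 0. *)
Lemma half_disk_product (s : C) :
  (Cmod s <= / 2)%R ->
  exists a b : C, (Cmod a ^ 2 + Cmod b ^ 2 = 1)%R /\ a * Cconj b = s.
Proof.
  intros Hs. pose proof (Cmod_ge_0 s) as Hs0.
  set (t := Cmod s) in *.
  set (d := sqrt (1 - 4 * t ^ 2)).
  assert (Hd : (d ^ 2 = 1 - 4 * t ^ 2)%R) by (apply pow2_sqrt; nra).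
  assert (Hd0 : (0 <= d)%R) by apply sqrt_pos.
  set (p := sqrt ((1 + d) / 2)).
  assert (Hp : (p ^ 2 = (1 + d) / 2)%R) by (apply pow2_sqrt; lra).
  assert (Hp0 : (0 < p)%R) by (apply sqrt_lt_R0; lra).
  assert (HpC : RtoC p <> 0) by (intros h; apply RtoC_inj in h; lra).
  exists (RtoC p), (Cconj (s / RtoC p)). split.
  - rewrite Cmod_conj, Cmod_div, !Cmod_R, Rabs_pos_eq by (assumption || lra).
    fold t.
    replace ((t / p) ^ 2)%R with (t ^ 2 / p ^ 2)%R by (field; lra).
    rewrite Hp. apply (Rmult_eq_reg_r ((1 + d) / 2)); [|lra].
    field_simplify; lra.
  - rewrite Cconj_conj. field. exact HpC.
Qed.

Theorem theorem4p3 :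
  forall (phi psi : C -> C) (mu : C) (psihat : nat -> C),
    mu <> RtoC 0 ->
    (forall z : C, unit_disk z -> phi z = Cmult mu z) ->
    (forall z : C, unit_disk z -> unit_disk (phi z)) ->
    holomorphic_on_disk psi ->
    power_series_on_disk psihat psi ->
    psihat 0%nat = RtoC 0 ->
    bounded_operator_on_dirichlet (weighted_composition psi phi) ->
    forall r : nat, (2 <= r)%nat ->
    forall w : C,
      (Cmod w <= sqrt (INR r + 1) / (2 * sqrt 2)
                 * Cmod (Cmult (psihat (r - 1)%nat) mu))%R ->
      numerical_range (weighted_composition psi phi) w.
Proof.
  intros phi psi mu psihat _ Hphi _ _ Hpsi H0 _ r hr w Hw.
  set (q := (psihat (r - 1)%nat * mu)) in *.
  assert (Hr : (0 < INR r + 1)%R) by (pose proof (pos_INR r); lra).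
  set (m := sqrt (INR r + 1)) in *.
  assert (Hm : (m ^ 2 = INR r + 1)%R) by (apply pow2_sqrt; lra).
  assert (Hm0 : (0 < m)%R) by (now apply sqrt_lt_R0).
  set (e := sqrt 2) in *.
  assert (He : (e ^ 2 = 2)%R) by (apply pow2_sqrt; lra).
  assert (He0 : (0 < e)%R) by (apply sqrt_lt_R0; lra).
  assert (HmC : RtoC m <> 0) by (intros h; apply RtoC_inj in h; lra).
  assert (HeC : RtoC e <> 0) by (intros h; apply RtoC_inj in h; lra).
  (* The operator contributes the factor (m / e) q; if q = 0 the disk is reduced
     to the origin and the division by it must be avoided. *)
  assert (Hs : exists s, (Cmod s <= / 2)%R /\ w = RtoC (m / e) * q * s).
  { destruct (Ceq_dec q 0) as [Hq|Hq].
    - exists 0. rewrite Cmod_0. split; [lra|].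
      rewrite Hq, Cmod_0, Rmult_0_r in Hw.
      rewrite (Cmod_eq_0 w) by (pose proof (Cmod_ge_0 w); lra). ring.
    - exists (w / (RtoC (m / e) * q)).
      assert (Hme : (0 < m / e)%R) by (now apply Rdiv_lt_0_compat).
      assert (HmeC : RtoC (m / e) <> 0) by (intros h; apply RtoC_inj in h; lra).
      assert (Hq0 : (0 < Cmod q)%R) by now apply Cmod_gt_0.
      split; [|field; now split].
      rewrite Cmod_div, Cmod_mult, Cmod_R, Rabs_pos_eq
        by (try apply Cmult_neq_0; assumption || lra).
      apply Rle_div_l; [now apply Rmult_lt_0_compat|].
      replace (/ 2 * (m / e * Cmod q))%R with (m / (2 * e) * Cmod q)%R
        by (field; lra).
      exact Hw. }
  destruct Hs as [s [Hs ->]].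
  destruct (half_disk_product s Hs) as (a & b & Hab & <-).
  exists (two_term r (a / RtoC e) (b / RtoC m)).
  split; [|split].
  - apply in_dirichlet_two_term. lia.
  - rewrite dirichlet_norm_two_term by lia.
    rewrite !Cmod_div, !Cmod_R, !Rabs_pos_eq by (assumption || lra).
    rewrite <- Hm, <- He. rewrite <- sqrt_1. f_equal. rewrite <- Hab.
    field. lra.
  - rewrite (weighted_two_term_inner _ _ _ _ r _ _ hr Hphi Hpsi H0). fold q.
    rewrite <- Hm, Cdiv_conj by assumption.
    rewrite RtoC_div, RtoC_pow by lra.
    replace (Cconj (RtoC m)) with (RtoC m)
      by (apply injective_projections; simpl; ring).
    field. now split.
Qed.
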